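(* There is a universal constant $c>0$ such that the following holds for every $0<\delta<c$. Let $X$ be a GNPC space, $B$ a tiny ball in $X$, $k\ge2$, and let $p_1,\dots,p_{k-1}\in B$ be a $(k-1,\delta)$-strainer at $p_k\in B$. Then for every $x\in B\setminus\{p_k\}$ sufficiently close to $p_k$ (i.e. $|xp_k|<\rho$ for some $\rho>0$ depending on $p_1,\dots,p_k$ and $\delta$) that satisfies $$|p_ip_k|=|p_ix|\quad\text{for all }1\le i\le k-1,$$ the sequence $p_1,\dots,p_k$ is a $(k,\delta)$-strainer at $x$.
   Context: A shortest path is an isometric embedding of a closed interval into a metric space. A complete geodesic space $(Y,d)$ is BNPC if for any two constant-speed reparametrized shortest paths $\gamma,\eta:[0,1]\to Y$, the function $t\mapsto d(\gamma(t),\eta(t))$ is convex on $[0,1]$. A metric space is locally BNPC if every point has a neighborhood that is BNPC with respect to the ambient metric. A geodesic is a curve whose restriction to each sufficiently small subinterval is a shortest path; a space is locally geodesically complete if every geodesic $\gamma:[a,b]\to X$ extends to a geodesic on $[a-\varepsilon,b+\varepsilon]$ for some $\varepsilon>0$. A GNPC space is a separable, locally compact, locally geodesically complete, locally BNPC metric space. A tiny ball in a GNPC space is an open metric ball $B$ of some radius $r$ such that the concentric closed ball of radius $10r$ is a compact BNPC space; shortest paths between points of $B$ are unique. Write $|ab|=d(a,b)$. Let $B$ be a tiny ball, $p\in B$, $q\in B\setminus\{p\}$, $x\in B\setminus\{q\}$, and let $x(t)$ be the unit-speed shortest path from $q$ to $x$. The angle viewed from $p$ at $q$ toward $x$ is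 $\angle pqx:=\lim_{t\to0}\tilde\angle pqx(t)$, where $\tilde\angle pqx(t)$ is the angle, at the vertex corresponding to $q$, of the Euclidean triangle with side lengths $|pq|$, $|px(t)|$, $|qx(t)|$ (the limit exists and $\cos\angle pqx=-\frac{d}{dt}\big|_{t=0^+}d(p,x(t))$). A point $p\in B$ is a $(1,\delta)$-strainer at $x\in B$ if there are $\bar p\in B$ (an opposite strainer for $p$ at $x$) and a neighborhood $U\subset B$ of $x$ with $p,\bar p\notin U$ such that $\angle py\bar p>\pi-\delta$ for all $y\in U$. Inductively, for $k\ge2$, $p_1,\dots,p_k\in B$ is a $(k,\delta)$-strainer at $x\in B$ if (1) $p_1,\dots,p_{k-1}$ is a $(k-1,\delta)$-strainer at $x$; (2) $p_k$ is a $(1,\delta)$-strainer at $x$; (3) there are an opposite strainer $\bar p_k$ for $p_k$ at $x$ and a neighborhood $U\subset B$ of $x$, not containing $p_1,\dots,p_k,\bar p_k$, such that $|\angle p_iyp_k-\pi/2|<\delta$ and $|\angle p_iy\bar p_k-\pi/2|<\delta$ for all $y\in U$ and $1\le i\le k-1$. *)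

(* Defs.v *)
(* Conventions.
   - A path defined on [a, b] is represented by a total function R -> X; only
     its values on [a, b] matter.
   - Metric notions about a subspace (e.g. a closed ball) are stated for a set
     Y of points of an ambient metric space, with the induced metric. *)
From HB Require Import structures.
From mathcomp Require Import all_boot all_order all_algebra.
From mathcomp Require Import all_classical all_reals all_analysis.
Set Implicit Arguments.
Unset Strict Implicit.
Unset Printing Implicit Defensive.
Import Order.TTheory GRing.Theory Num.Theory.
Import numFieldNormedType.Exports.
Local Open Scope classical_set_scope.
Local Open Scope ring_scope.

Section MetricGeometry.
Context {R : realType} {X : metricType R}.
Implicit Types (a b t : R) (g h : R -> X) (p q x y : X) (Y B U : set X).

Definition shortest_path a b g : Prop :=
  a <= b /\ {in `[a, b] &, forall s t, mdist (g s) (g t) = `|s - t|}.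

Definition shortest_path_in Y a b g : Prop :=
  shortest_path a b g /\ g @` `[a, b] `<=` Y.

(* [g] on [0, 1] is the affine reparametrization of a shortest path on [a, b];
   constant paths (a = b) are included. *)
Definition const_speed_path_in Y g : Prop :=
  exists a b h, shortest_path_in Y a b h /\
    {in `[0, 1], forall t, g t = h ((1 - t) * a + t * b)}.

Definition geodesic_space Y : Prop := forall x y, Y x -> Y y ->
  exists a b g, [/\ shortest_path_in Y a b g, g a = x & g b = y].

Definition complete_subspace Y : Prop :=
  forall F : set_system X, ProperFilter F -> F Y -> cauchy F ->
    exists2 y, Y y & F --> y.

Definition BNPC Y : Prop :=
  [/\ complete_subspace Y, geodesic_space Y &
      forall g h, const_speed_path_in Y g -> const_speed_path_in Y h ->
        convex_function (`[0, 1]%classic : set R^o)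
          (fun t => mdist (g t) (h t))].

Definition geodesic a b g : Prop :=
  exists2 e, 0 < e & forall s t,
    a <= s -> s <= t -> t <= b -> t - s < e -> shortest_path s t g.

(* The library's [closed_ball] is the closure of the open ball, which in a
   general metric space can be smaller. *)
Definition cball x (r : R) : set X := [set y | mdist x y <= r].

Definition tiny_ball B : Prop := exists x (r : R),
  [/\ 0 < r, B = ball x r, compact (cball x (10 * r)) & BNPC (cball x (10 * r))].

(* Law of cosines: the angle, between the sides of lengths |pq| and |qx|, of the
   Euclidean triangle with side lengths |pq|, |px|, |qx|. *)
Definition comparison_angle p q x : R :=
  acos ((mdist p q ^+ 2 + mdist q x ^+ 2 - mdist p x ^+ 2)
        / (2 * mdist p q * mdist q x)).

Definition unit_speed_path q x g : Prop :=
  [/\ shortest_path 0 (mdist q x) g, g 0 = q & g (mdist q x) = x].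

(* Meaningful for p, x distinct from q, all three in a tiny ball: the shortest
   path from q to x then exists and is unique on [0, |qx|], so the choice made
   here does not matter. *)
Definition angle p q x : R :=
  let g := xget (fun=> q) (unit_speed_path q x) in
  lim (comparison_angle p q (g t) @[t --> 0^'+]).

Definition opposite_strainer B (delta : R) p x pbar : Prop :=
  B pbar /\ exists U, [/\ nbhs x U, U `<=` B, ~ U p, ~ U pbar &
    forall y, U y -> pi - delta < angle p y pbar].

Definition strainer1 B (delta : R) p x : Prop :=
  B p /\ exists pbar, opposite_strainer B delta p x pbar.

(* The list [ps] is p_1, ..., p_k. *)
Inductive strainer B (delta : R) : nat -> seq X -> X -> Prop :=
| strainer_base p x : strainer1 B delta p x -> strainer B delta 1 [:: p] x
| strainer_step k ps p x :
    strainer B delta k ps x ->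
    strainer1 B delta p x ->
    (exists pbar U, [/\ opposite_strainer B delta p x pbar,
       nbhs x U, U `<=` B,
       [/\ forall q, q \in ps -> ~ U q, ~ U p & ~ U pbar] &
       forall y q, U y -> q \in ps ->
         `|angle q y p - pi / 2| < delta /\
         `|angle q y pbar - pi / 2| < delta]) ->
    strainer B delta k.+1 (rcons ps p) x.

End MetricGeometry.

Definition locally_BNPC (R : realType) (X : metricType R) : Prop :=
  forall x : X, exists2 U : set X, nbhs x U & BNPC U.

Definition locally_geodesically_complete (R : realType) (X : metricType R)
  : Prop :=
  forall (a b : R) (g : R -> X), a < b -> geodesic a b g ->
    exists (e : R) (h : R -> X),
      [/\ 0 < e, geodesic (a - e) (b + e) h & {in `[a, b], h =1 g}].

Definition separable (X : topologicalType) : Prop :=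
  exists2 D : set X, countable D & dense D.

Definition GNPC (R : realType) (X : metricType R) : Prop :=
  [/\ separable X, locally_compact [set: X],
      locally_geodesically_complete X & locally_BNPC X].

(* Main.v *)
Require Import Defs.
From mathcomp Require Import all_boot all_order all_algebra.
From mathcomp Require Import all_classical all_reals all_analysis.
From mathcomp Require Import ring lra.
Set Implicit Arguments.
Unset Strict Implicit.
Unset Printing Implicit Defensive.
Import Order.TTheory GRing.Theory Num.Theory.
Import numFieldNormedType.Exports.
Local Open Scope classical_set_scope.
Local Open Scope ring_scope.

(** Write [q] for the last point of the sequence and [s] for the distance from
    [q] to [x].  Along a shortest path leaving [y] the distance from [p] is
    convex, and the cosine of the angle viewed from [p] is minus its initial
    slope ([angle_slope]).  By convexity this slope lies between the difference
    quotients taken on any segment before [y] and on any segment after [y] of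
    one shortest path through [y] ([angle_bounds]).  All angle conditions thus
    become estimates of distances between finitely many points, and the task is
    to choose the points before and after [y] well.  Prolongability of shortest
    paths supplies the candidates, and compactness two facts that hold
    uniformly close to [q].

    - [nearly_conic]: the distance from [p] is almost linear along shortest
      paths issuing from [q].  The difference quotients at [q] are monotone,
      hence have a limit, and they depend on the direction in an
      equicontinuous way, so that the convergence is uniform.

    - [prolongation_returns]: let [xb] be a point on a prolongation of [q x] at a
      fixed distance [r] from [q].  If a shortest path from [xb] to a point
      close to [x] is prolonged by [s], it ends within a small multiple of [s]
      from [q].  Otherwise the prolonged paths would branch off at infinitely
      many scales, and convexity would amplify the branching to a fixed
      distance between the ends of infinitely many paths that start close
      together and stay in a compact set.

    The second fact says that the distance from [q] grows at almost unit speed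
    from [y] towards [xb], so that [xb] is an opposite strainer for [q] at [x].
    Let [p] be another point of the sequence.  Since [q] and [x] are equally far
    from [p], by the first fact the distance from [p] exceeds its value at [q]
    only little, relative to [s], on a prolongation of [q y] by [s].  This
    bounds its slope at [y] towards [q] from below; from above, the slope is
    bounded by the difference between the values at [q] and at [y].  Towards [xb] the first
    fact bounds the slope from above, and the second bounds it from below.  All
    these slopes are therefore as small as desired, hence smaller than the sine
    of [delta]; the strainer conditions on the other points are open and
    therefore persist at [x].  The bound on [delta] keeps it below a right
    angle. *)

(** * Shortest paths *)

Section Paths.
Context {R : realType} {X : metricType R}.
Implicit Types (a b c p q x y z : X) (g h : R -> X) (s t l : R) (Y D : set X).

Lemma mdist_lipschitz p x y : `|mdist p x - mdist p y| <= mdist x y.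
Proof.
have := metric_triangle p x y; have := metric_triangle p y x.
by rewrite (metric_sym y x) ler_distl => *; apply/andP; split; lra.
Qed.

Lemma mdist_pos x y : x <> y -> 0 < mdist x y.
Proof. by move=> /eqP; rewrite mdist_gt0. Qed.

Lemma mdist_gt0_neq x y : 0 < mdist x y -> x <> y.
Proof. by rewrite mdist_gt0 => /eqP. Qed.

Definition at_ratio t a b c :=
  mdist a c = t * mdist a b /\ mdist c b = (1 - t) * mdist a b.

Lemma shortest_path_ends (a b : R) g : shortest_path a b g -> mdist (g a) (g b) = b - a.
Proof.
move=> [ab gE]; rewrite gE ?in_itv/= ?lexx ?ab//.
by rewrite distrC ger0_norm// subr_ge0.
Qed.

Lemma shortest_pathE (a b : R) g s t : shortest_path a b g ->
  a <= s -> s <= t -> t <= b -> mdist (g s) (g t) = t - s.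
Proof.
move=> [ab gE] as_ st tb.
have sI : s \in `[a, b] by rewrite in_itv/= as_ (le_trans st).
have tI : t \in `[a, b] by rewrite in_itv/= tb (le_trans as_).
by rewrite gE// distrC ger0_norm// subr_ge0.
Qed.

Lemma shortest_path_sub (a b : R) g s t : shortest_path a b g ->
  a <= s -> s <= t -> t <= b -> shortest_path s t g.
Proof.
move=> [ab gE] as_ st tb; split=> // u v; rewrite !in_itv/= => /andP[su ut] /andP[sv vt].
by apply: gE; rewrite in_itv/=; apply/andP; split;
  [apply: le_trans as_ _|apply: le_trans tb|apply: le_trans as_ _|apply: le_trans tb].
Qed.

(** A path that does not increase distances and whose endpoints are as far
    apart as its domain is long cannot lose length anywhere. *)
Lemma lipschitz_shortest_path l g : 0 <= l -> mdist (g 0) (g l) = l ->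
  (forall s t, 0 <= s -> s <= t -> t <= l -> mdist (g s) (g t) <= t - s) ->
  shortest_path 0 l g.
Proof.
move=> l0 gl lip; split=> // s t.
have key u v : 0 <= u -> u <= v -> v <= l -> mdist (g u) (g v) = v - u.
  move=> u0 uv vl; have := lip _ _ u0 uv vl.
  have := lip 0 u (lexx _) u0 (le_trans uv vl).
  have := lip v l (le_trans u0 uv) vl (lexx _).
  have := metric_triangle (g 0) (g u) (g l); have := metric_triangle (g u) (g v) (g l).
  by rewrite gl; move=> *; lra.
rewrite !in_itv/= => /andP[s0 sl] /andP[t0 tl].
have [st|/ltW ts] := leP s t.
  by rewrite key// distrC ger0_norm// subr_ge0.
by rewrite metric_sym key// ger0_norm// subr_ge0.
Qed.

Lemma concat_unit_speed_path a b c g h : mdist a c + mdist c b = mdist a b ->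
  unit_speed_path a c g -> unit_speed_path c b h ->
  unit_speed_path a b (fun t => if t <= mdist a c then g t else h (t - mdist a c)).
Proof.
move=> acb [gs g0 gc] [hs h0 hb].
have ac0 := mdist_ge0 a c; have cb0 := mdist_ge0 c b; have ab0 := mdist_ge0 a b.
set k := (fun t => if t <= mdist a c then g t else h (t - mdist a c)).
have k0 : k 0 = a by rewrite /k ac0.
have kl : k (mdist a b) = b.
  rewrite /k -acb; case: ifPn => [H|_].
    have cb : mdist c b = 0 by lra.
    by rewrite cb addr0 gc; apply: mdist_positivity.
  by rewrite [X in h X]addrC addKr.
split => //; apply: lipschitz_shortest_path => // [|s t s0 st tl]; first by rewrite k0 kl.
rewrite /k; have [sc|cs] := leP s (mdist a c); have [tc|ct] := leP t (mdist a c).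
- by rewrite (shortest_pathE gs).
- have gsc : mdist (g s) c = mdist a c - s by rewrite -(shortest_pathE gs) ?gc.
  have chs : mdist c (h (t - mdist a c)) = t - mdist a c - 0.
    by rewrite -(shortest_pathE hs) ?h0//; lra.
  have := metric_triangle (g s) c (h (t - mdist a c)); lra.
- by lra.
- rewrite (shortest_pathE hs); lra.
Qed.

Lemma unit_speed_path_ratio a b g t : unit_speed_path a b g -> 0 <= t <= 1 ->
  at_ratio t a b (g (t * mdist a b)).
Proof.
move=> [gs g0 gb] /andP[t0 t1]; have ab0 := mdist_ge0 a b.
have h1 : 0 <= t * mdist a b by rewrite mulr_ge0.
have h2 : t * mdist a b <= mdist a b by rewrite ler_piMl.
have := shortest_pathE gs (lexx _) h1 h2; have := shortest_pathE gs h1 h2 (lexx _).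
by rewrite g0 gb /at_ratio => -> ->; split; ring.
Qed.

Lemma path_point_ratio g (a b : R) t s : shortest_path a b g -> a <= s <= b ->
  s = (1 - t) * a + t * b -> at_ratio t (g a) (g b) (g s).
Proof.
move=> gs /andP[as_ sb] sE; rewrite /at_ratio (shortest_path_ends gs).
by rewrite !(shortest_pathE gs) ?lexx//; split; rewrite sE; ring.
Qed.

(** Convexity between the two pairs of endpoints, freed of the
    reparametrization over [0, 1]. *)
Lemma BNPC_paths Y (a b : R) g (c d : R) h t : BNPC Y ->
  shortest_path_in Y a b g -> shortest_path_in Y c d h -> 0 <= t <= 1 ->
  mdist (g ((1 - t) * a + t * b)) (h ((1 - t) * c + t * d)) <=
  (1 - t) * mdist (g a) (h c) + t * mdist (g b) (h d).
Proof.
move=> [_ _ conv] gY hY t01.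
pose g1 t := g ((1 - t) * a + t * b); pose h1 t := h ((1 - t) * c + t * d).
have g1P : const_speed_path_in Y g1 by exists a, b, g; split.
have h1P : const_speed_path_in Y h1 by exists c, d, h; split.
have := conv _ _ g1P h1P.
have /andP[t0 t1] := t01.
pose u : {i01 R} := Itv01 t0 t1.
have m0 : (0 : R) \in (`[0, 1]%classic : set R^o) by rewrite inE/= in_itv/= lexx ler01.
have m1 : (1 : R) \in (`[0, 1]%classic : set R^o) by rewrite inE/= in_itv/= lexx ler01.
move=> /(_ u 1 0 m1 m0).
have uE : convex.conv u (1 : convex_lmodType R^o) (0 : convex_lmodType R^o) = t :> R.
  by change (t * 1 + (1 - t) * 0 = t); ring.
rewrite convRE /unstable.onem uE /=.
rewrite /g1 /h1; have e0 (x y : R) : (1 - 0) * x + 0 * y = x by ring.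
have e1 (x y : R) : (1 - 1) * x + 1 * y = y by ring.
by rewrite !e0 !e1 => H; rewrite [leRHS]addrC.
Qed.

End Paths.

(** * The geometry of a tiny ball *)

Section TinyBall.
Context {R : realType} {X : metricType R}.
Implicit Types (a b c p q x y z : X) (g h : R -> X) (s t l L : R) (Y D : set X).

(** What is used of a tiny ball, phrased through distances between points only:
    convexity of the distance in [bd_convex] already entails uniqueness of
    shortest paths, and [bd_extend] is the global form of the local geodesic
    completeness of the ambient space. *)
Record busemann_domain D : Prop := BusemannDomain {
  bd_compact : compact D;
  bd_path : forall a b, D a -> D b -> exists g, unit_speed_path a b g;
  bd_ratio : forall t a b c, 0 <= t <= 1 -> D a -> D b ->
    at_ratio t a b c -> D c;
  bd_convex : forall t a b c a' b' c', 0 <= t <= 1 ->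
    D a -> D b -> D a' -> D b' ->
    at_ratio t a b c -> at_ratio t a' b' c' ->
    mdist c c' <= (1 - t) * mdist a a' + t * mdist b b';
  bd_extend : forall a x L, D a -> D x -> a <> x -> mdist a x <= L ->
    cball a L `<=` D ->
    exists2 b, mdist a b = L & mdist x b = L - mdist a x }.

Lemma BNPC_unit_speed_path Y a b : BNPC Y -> Y a -> Y b ->
  exists2 g, unit_speed_path a b g & g @` `[0, mdist a b] `<=` Y.
Proof.
move=> [_ geo _] Ya Yb; have [u [v [g [[gs gY] gu gv]]]] := geo _ _ Ya Yb.
have abE : mdist a b = v - u by rewrite -gu -gv (shortest_path_ends gs).
have uv : u <= v by case: gs.
exists (fun t => g (u + t)); last first.
  move=> _ [t /= + <-]; rewrite in_itv/= => /andP[t0 tl]; apply: gY.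
  by exists (u + t) => //=; rewrite in_itv/=; apply/andP; split; lra.
split; rewrite ?addr0 ?abE ?subrKC//.
apply: lipschitz_shortest_path; first by lra.
  by rewrite addr0 subrKC (shortest_path_ends gs).
by move=> s t s0 st tl; rewrite (shortest_pathE gs); lra.
Qed.

Lemma mdist_continuous p : continuous (mdist p).
Proof.
move=> x; apply/cvgrPdist_lt => e e0.
apply/metricType_numDomainType.nbhs_mdistP.
by exists e => //= y xy; apply: le_lt_trans (mdist_lipschitz _ _ _) xy.
Qed.

Lemma ratio_between t a b c : at_ratio t a b c -> mdist a c + mdist c b = mdist a b.
Proof. by move=> [-> ->]; ring. Qed.

Section TinyBallDomain.
Variables (o : X) (r : R).
Hypotheses (r0 : 0 < r) (Ycompact : compact (cball o (10 * r)))
  (YB : BNPC (cball o (10 * r))) (lgc : locally_geodesically_complete X).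
Let Y := cball o (10 * r).
Let D := cball o (3 * r).

Let DY a : D a -> Y a.
Proof. by rewrite /D /Y /cball/=; have := r0; lra. Qed.

(* The union of the shortest paths between points of D stays well inside Y. *)
Let between_mem a b c : D a -> D b -> mdist a c + mdist c b = mdist a b ->
  mdist o c <= 6 * r.
Proof.
rewrite /D /cball/= => oa ob acb.
have := metric_triangle o a c; have := metric_triangle o b c.
have := metric_triangle a o b; rewrite (metric_sym b c) (metric_sym a o); lra.
Qed.

Let path_mem a b g : D a -> D b -> unit_speed_path a b g ->
  shortest_path_in Y 0 (mdist a b) g.
Proof.
move=> Da Db [gs g0 gl]; split=> // _ [t /= + <-]; rewrite in_itv/= => /andP[t0 tl].
suff : mdist o (g t) <= 6 * r by rewrite /Y /cball/=; have := r0; lra.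
apply: between_mem Da Db _; rewrite -[X in mdist X (g t)]g0 -[X in mdist (g t) X]gl.
by rewrite !(shortest_pathE gs)//; lra.
Qed.

(* Points dividing [a b] in a given ratio are points of shortest paths from a to
   b, because two shortest paths through such a point can be concatenated. *)
Let convexD t a b c a' b' c' : 0 <= t <= 1 ->
    D a -> D b -> D a' -> D b' ->
    at_ratio t a b c -> at_ratio t a' b' c' ->
    mdist c c' <= (1 - t) * mdist a a' + t * mdist b b'.
Proof.
have path_through u v w : D u -> D v -> at_ratio t u v w ->
    exists2 g, unit_speed_path u v g & g (t * mdist u v) = w.
  move=> Du Dv wt; have uwv := ratio_between wt.
  have Yw : Y w by have := between_mem Du Dv uwv; rewrite /Y /cball/=; have := r0; lra.
  have [g gP _] := BNPC_unit_speed_path YB (DY Du) Yw.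
  have [h hP _] := BNPC_unit_speed_path YB Yw (DY Dv).
  eexists; first exact: concat_unit_speed_path uwv gP hP.
  by have [<- _] := wt; rewrite lexx; case: gP.
move=> t01 Da Db Da' Db' ct ct'.
have [g gP <-] := path_through _ _ _ Da Db ct.
have [h hP <-] := path_through _ _ _ Da' Db' ct'.
have := BNPC_paths YB (path_mem Da Db gP) (path_mem Da' Db' hP) t01.
rewrite !mulr0 !add0r.
by case: gP => _ -> ->; case: hP => _ -> ->.
Qed.

Let ratioD t a b c : 0 <= t <= 1 -> D a -> D b -> at_ratio t a b c -> D c.
Proof.
move=> t01 Da Db ct; have Do : D o by rewrite /D /cball/= mdistxx; have := r0; lra.
have oo : at_ratio t o o o by rewrite /at_ratio mdistxx !mulr0.
have := convexD t01 Do Do Da Db oo ct.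
have /andP[t0 t1] := t01.
have : (1 - t) * mdist o a <= (1 - t) * (3 * r) by rewrite ler_wpM2l// subr_ge0.
have : t * mdist o b <= t * (3 * r) by rewrite ler_wpM2l.
rewrite /D /cball/=; lra.
Qed.

Let pathD a b : D a -> D b -> exists g, unit_speed_path a b g.
Proof.
by move=> Da Db; have [g] := BNPC_unit_speed_path YB (DY Da) (DY Db); exists g.
Qed.

Let compactD : compact D.
Proof.
apply: (subclosed_compact _ Ycompact) => [|a]; last exact: DY.
have -> : D = (mdist o) @^-1` [set t | t <= 3 * r] by [].
apply: closed_comp => [x _|]; last exact: closed_le.
exact: mdist_continuous.
Qed.

(** A farthest point behind [x] on a prolongation of [a x] within length [L]
    exists by compactness.  Were it closer to [a] than [L], a local
    prolongation past it would still be shortest from [a], since the distance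
    from [a] is convex on it and already grows at unit speed before it. *)
Let extendD a x L : D a -> D x -> a <> x -> mdist a x <= L ->
  cball a L `<=` D ->
  exists2 b, mdist a b = L & mdist x b = L - mdist a x.
Proof.
move=> Da Dx ax axL LD.
pose K := [set b | mdist x b - mdist a b = - mdist a x] `&` cball a L.
have Kx : K x by split => //=; rewrite mdistxx sub0r.
have cK : compact K.
  apply: (subclosed_compact _ compactD) => [|b []]; last by move=> _ /LD.
  apply: closedI.
    apply: (@closed_comp _ _ (fun b => mdist x b - mdist a b) [set - mdist a x]).
      by move=> b _; apply: cvgB; apply: mdist_continuous.
    exact: closed_eq.
  apply: (@closed_comp _ _ (mdist a) [set t | t <= L]); last exact: closed_le.
  by move=> b _; exact: mdist_continuous.
have [b] : exists2 b, b \in K & forall c, c \in K -> mdist a c <= mdist a b.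
  apply: compact_EVT_max => //; first by exists x.
  by apply: continuous_subspaceT => b; exact: mdist_continuous.
rewrite inE => -[/= bE bL] bmax.
have [Lb|bltL] := leP L (mdist a b).
  have abL : mdist a b = L by apply/eqP; rewrite eq_le bL.
  by exists b => //; rewrite -abL; lra.
exfalso.
have axP := mdist_pos ax; have xb0 := mdist_ge0 x b.
set l := mdist a b in bE bL bmax bltL *.
have l0 : 0 < l by lra.
have Db : D b by exact: LD.
have [g gP] := pathD Da Db.
have [gs g0 gl] := gP; rewrite -/l in gs gl.
have geo : geodesic 0 l g.
  exists 1 => // s t s0 st tl _; exact: shortest_path_sub gs s0 st tl.
have [e [h [e0 [e' e'0 hgeo] hg]]] := lgc l0 geo.
pose n := Num.min (Num.min e (e' / 4)) (Num.min l (L - l)).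
have [n0 ne ne' nl nL] : [/\ 0 < n, n <= e, n <= e' / 4, n <= l & n <= L - l].
  rewrite /n !lt_min !ge_min !lexx !orbT /=; split => //.
  by rewrite e0 l0 subr_gt0 bltL divr_gt0.
have hs : shortest_path (l - n) (l + n) h by apply: hgeo; lra.
have hE t : 0 <= t <= l -> h t = g t by move=> tI; apply: hg; rewrite in_itv.
have hln : h (l - n) = g (l - n) by apply: hE; lra.
have hl : h l = b by rewrite hE ?gl//; lra.
have ahln : mdist a (h (l - n)) = l - n.
  rewrite hln -[X in mdist X _]g0 (shortest_pathE gs) ?subr0//; lra.
have bhln : mdist b (h (l + n)) = n.
  by rewrite -hl (shortest_pathE hs) //; lra.
have Dhl : D (h (l - n)) by apply: LD; rewrite /cball/=; lra.
have Dhr : D (h (l + n)).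
  by apply: LD; have := metric_triangle a b (h (l + n)); rewrite /cball/= -/l; lra.
have bmid : at_ratio (1 / 2) (h (l - n)) (h (l + n)) b.
  by rewrite -hl; apply: path_point_ratio hs _ _; lra.
have amid : at_ratio (1 / 2) a a a by rewrite /at_ratio mdistxx !mulr0.
have half01 : 0 <= (1 / 2 : R) <= 1 by lra.
have := convexD half01 Da Da Dhl Dhr amid bmid.
rewrite -/l ahln => cvx.
have := metric_triangle a b (h (l + n)); have := metric_triangle x b (h (l + n)).
have := metric_triangle a x (h (l + n)); rewrite bhln -/l => t1 t2 t3.
have : mdist a (h (l + n)) <= l.
  by apply: bmax; rewrite inE; split; rewrite /cball/=; lra.
lra.
Qed.

Lemma tiny_ball_busemann : busemann_domain D.
Proof. by split. Qed.

End TinyBallDomain.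
End TinyBall.

(** * The angle as an initial slope *)

(** The endpoints of [-1, 1] matter here: opposite directions lead to one. *)
Lemma acos_cvg (R : realType) (T : Type) (F : set_system T) (FF : Filter F)
    (u : T -> R) (v : R) : -1 <= v <= 1 ->
  (\forall t \near F, -1 <= u t <= 1) -> u t @[t --> F] --> v ->
  acos (u t) @[t --> F] --> acos v.
Proof.
move=> vI uI uv; apply/cvgrPdist_lt => e e0.
have [a0 api] : 0 <= acos v <= pi /\ cos (acos v) = v by exact: acos_def.
have pi0 := @pi_gt0 R.
(* Where the bound leaves [0, pi] it holds trivially, elsewhere the cosine is
   decreasing. *)
have below : \forall t \near F, acos (u t) < acos v + e.
  have [big|small] := ltP pi (acos v + e).
    by near=> t; apply: le_lt_trans big; apply: acos_lepi; near: t.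
  have cosv : cos (acos v + e) < v.
    by rewrite -{2}api ltr_cos ?in_itv/=; have := a0; lra.
  have e2 : 0 < v - cos (acos v + e) by lra.
  have near_v : \forall t \near F, cos (acos v + e) < u t.
    by have /cvgrPdist_lt/(_ _ e2) := uv; apply: filterS => t; rewrite ltr_distlC; lra.
  near=> t; have uI' : -1 <= u t <= 1 by near: t.
  have [b0 bpi] := acos_def uI'.
  rewrite -ltr_cos ?in_itv/= ?bpi//; first by near: t.
  by have := a0; lra.
have above : \forall t \near F, acos v - e < acos (u t).
  have [big|small] := ltP (acos v - e) 0.
    by near=> t; apply: lt_le_trans big _; apply: acos_ge0; near: t.
  have cosv : v < cos (acos v - e).
    by rewrite -{1}api ltr_cos ?in_itv/=; have := a0; lra.
  have e2 : 0 < cos (acos v - e) - v by lra.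
  have near_v : \forall t \near F, u t < cos (acos v - e).
    by have /cvgrPdist_lt/(_ _ e2) := uv; apply: filterS => t; rewrite ltr_distlC; lra.
  near=> t; have uI' : -1 <= u t <= 1 by near: t.
  have [b0 bpi] := acos_def uI'.
  rewrite -ltr_cos ?in_itv/= ?bpi//; first by near: t.
  by have := a0; lra.
near=> t; rewrite ltr_distlC; apply/andP; split; near: t => //.
Unshelve. all: by end_near. Qed.

Section DomainFacts.
Context {R : realType} {X : metricType R} (D : set X).
Hypothesis BD : busemann_domain D.
Implicit Types (a b c p q x y z w : X) (g : R -> X) (t : R).

Lemma between_ratio a b c : mdist a c + mdist c b = mdist a b -> a <> b ->
  at_ratio (mdist a c / mdist a b) a b c /\ 0 <= mdist a c / mdist a b <= 1.
Proof.
move=> acb /mdist_pos ab0; have ac0 := mdist_ge0 a c; have cb0 := mdist_ge0 c b.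
rewrite /at_ratio divfK ?gt_eqF// mulrBl mul1r divfK ?gt_eqF//; split.
  by split => //; rewrite -acb; ring.
by rewrite divr_ge0 ?(ltW ab0)//= ler_pdivrMr//; lra.
Qed.

Lemma between_degenerate a c : mdist a c + mdist c a = mdist a a -> c = a.
Proof.
rewrite mdistxx => H; apply: mdist_positivity.
have := mdist_ge0 a c; have := mdist_ge0 c a; lra.
Qed.

Lemma between_mem a b c : D a -> D b -> mdist a c + mdist c b = mdist a b -> D c.
Proof.
move=> Da Db acb; have [ab|ab] := pselect (a = b).
  by subst b; rewrite (between_degenerate acb).
have [ct t01] := between_ratio acb ab; exact: (bd_ratio BD t01 Da Db ct).
Qed.

Lemma between_unique a b c c' : D a -> D b ->
  mdist a c + mdist c b = mdist a b -> mdist a c' + mdist c' b = mdist a b ->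
  mdist a c = mdist a c' -> c = c'.
Proof.
move=> Da Db acb acb' cc'; have [ab|ab] := pselect (a = b).
  by subst b; rewrite (between_degenerate acb) (between_degenerate acb').
have [ct t01] := between_ratio acb ab; have [+ _] := between_ratio acb' ab.
rewrite -cc' => ct'; apply: mdist_positivity.
have := bd_convex BD t01 Da Db Da Db ct ct'; rewrite !mdistxx !mulr0 addr0.
by have := mdist_ge0 c c'; lra.
Qed.

(** The inequality is multiplied by the distance of [a] and [b] in order to
    include [a = b]. *)
Lemma dist_convex p a b c : D p -> D a -> D b ->
  mdist a c + mdist c b = mdist a b ->
  mdist a b * mdist p c <= mdist c b * mdist p a + mdist a c * mdist p b.
Proof.
move=> Dp Da Db acb; have [ab|ab] := pselect (a = b).
  by subst b; rewrite (between_degenerate acb) mdistxx !mul0r addr0.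
have [ct t01] := between_ratio acb ab; have ab0 := mdist_pos ab.
have pp : at_ratio (mdist a c / mdist a b) p p p by rewrite /at_ratio mdistxx !mulr0.
move: (mdist a c / mdist a b) ct t01 pp => t ct t01 pp.
have := bd_convex BD t01 Dp Dp Da Db pp ct; have [-> ->] := ct.
by move=> /(ler_wpM2l (ltW ab0)); lra.
Qed.

Lemma path_through a b c g : D a -> D b -> unit_speed_path a b g ->
  mdist a c + mdist c b = mdist a b -> g (mdist a c) = c.
Proof.
move=> Da Db [gs g0 gl] acb; have ac0 := mdist_ge0 a c; have cb0 := mdist_ge0 c b.
have agc : mdist a (g (mdist a c)) = mdist a c.
  by rewrite -[X in mdist X (g _)]g0 (shortest_pathE gs) ?subr0//; lra.
apply: (between_unique Da Db _ acb agc); rewrite agc -[X in mdist (g _) X]gl.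
by rewrite (shortest_pathE gs)//; lra.
Qed.

(** The first variation formula: the cosine of the angle is minus the initial
    slope of the distance from [p], which is the infimum of its difference
    quotients because that distance is convex along a shortest path. *)
Lemma angle_slope p y z : D p -> D y -> D z -> p <> y -> y <> z ->
  exists g s, let S t := (mdist p (g t) - mdist p y) / t in
  [/\ unit_speed_path y z g, -1 <= s <= 1, angle p y z = acos (- s),
    forall t, 0 < t <= mdist y z -> s <= S t &
    forall A, (forall t, 0 < t <= mdist y z -> A <= S t) -> A <= s].
Proof.
move=> Dp Dy Dz py yz.
have l0 := mdist_pos yz; set l := mdist y z in l0 *.
have f00 := mdist_pos py; set f0 := mdist p y in f00 *.
rewrite /angle; set g := xget _ _.
have gP : unit_speed_path y z g by apply: xgetPex; exact: (bd_path BD).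
exists g => /=; have [gs g0 gl] := gP; rewrite -/l in gs gl.
have ygt t : 0 <= t <= l -> mdist y (g t) = t.
  by move=> tI; rewrite -[X in mdist X _]g0 (shortest_pathE gs) ?subr0//; lra.
have ggt t u : 0 <= t -> t <= u -> u <= l -> mdist (g t) (g u) = u - t.
  by move=> *; rewrite (shortest_pathE gs).
have Dg t : 0 <= t <= l -> D (g t).
  move=> tI; apply: between_mem Dy Dz _.
  by rewrite ygt// -[X in mdist (g _) X]gl ggt -/l; lra.
pose S t := (mdist p (g t) - f0) / t.
have Smono t u : 0 < t -> t <= u -> u <= l -> S t <= S u.
  move=> t0 tu ul; have u0 : 0 < u by lra.
  have := @dist_convex p y (g u) (g t) Dp Dy.
  rewrite !ygt; try lra.
  rewrite ggt; try lra.
  move=> /(_ (Dg _ _)); rewrite -/f0 => cvx.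
  rewrite /S ler_pdivrMr// mulrAC ler_pdivlMr//.
  have := cvx _ _; lra.
have Sbound t : 0 < t <= l -> -1 <= S t <= 1.
  move=> /andP[t0 tl]; rewrite /S ler_pdivlMr// ler_pdivrMr// mulN1r mul1r.
  have := mdist_lipschitz p (g t) y; rewrite (metric_sym (g t)) ygt; last lra.
  by rewrite -/f0 ler_norml.
have lI : 0 < l <= l by lra.
pose E := [set S t | t in [set t | 0 < t <= l]].
have Elb : lbound E (-1) by move=> _ [t /= tI <-]; have := Sbound _ tI; lra.
have E0 : E !=set0 by exists (S l), l.
have Einf : has_inf E by split => //; exists (-1).
pose s := inf E.
have sS t : 0 < t <= l -> s <= S t.
  by move=> tI; apply: ge_inf; [exists (-1)|exists t].
have glb A : (forall t, 0 < t <= l -> A <= S t) -> A <= s.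
  by move=> AS; apply: lb_le_inf => // _ [t /= tI <-]; exact: AS.
have s1 : -1 <= s <= 1.
  apply/andP; split; first by apply: glb => t /Sbound; lra.
  by apply: le_trans (sS _ lI) _; have := Sbound _ lI; lra.
exists s; split => //.
apply: cvg_lim => //.
have sN : -1 <= - s <= 1 by lra.
have near_l : \forall t \near 0^'+, 0 < t <= l.
  near=> t; apply/andP; split; near: t.
    exact: nbhs_right_gt.
  exact: nbhs_right_le.
(* With f = f0 + t S, the law of cosines is affine in the difference quotient S
   up to a term that vanishes with t. *)
have quotE t : 0 < t <= l ->
    (f0 ^+ 2 + mdist y (g t) ^+ 2 - mdist p (g t) ^+ 2) / (2 * f0 * mdist y (g t))
    = - S t + t * (1 - S t ^+ 2) / (2 * f0).
  move=> tI; rewrite ygt; last lra.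
  rewrite /S; field; apply/andP; split; rewrite gt_eqF//; lra.
apply: acos_cvg sN _ _.
  apply: filterS near_l => t tI; rewrite -/f0.
  have t0 : 0 < t by lra.
  have f0t : 0 < 2 * f0 * mdist y (g t) by rewrite ygt ?mulr_gt0//; lra.
  have := mdist_lipschitz p (g t) y; rewrite -/f0 (metric_sym (g t)) ler_norml.
  have := metric_triangle y p (g t); rewrite (metric_sym y p) -/f0.
  have := mdist_ge0 p (g t).
  rewrite ler_pdivlMr// ler_pdivrMr// ygt; last lra.
  by move=> *; apply/andP; split; nra.
apply/cvgrPdist_lt => e e0.
have [_ [t0 /= t0I <-] St0] : exists2 v, E v & v < s + e / 2.
  by apply: inf_adherent => //; lra.
near=> t.
have tI : 0 < t <= l by near: t.
rewrite -/f0 quotE//.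
have tt0 : t <= t0.
  by near: t; apply: nbhs_right_le; lra.
have tsmall : t <= e * f0 / 2.
  by near: t; apply: nbhs_right_le; rewrite divr_gt0// mulr_gt0.
have SI := Sbound _ tI.
have : S t <= S t0 by apply: Smono; lra.
have := sS _ tI.
have : 0 <= t * (1 - S t ^+ 2) / (2 * f0) <= e / 4.
  apply/andP; split.
    by rewrite divr_ge0 ?mulr_ge0//; nra.
  rewrite ler_pdivrMr; last lra.
  have : t * (1 - S t ^+ 2) <= t * 1 by rewrite ler_wpM2l//; nra.
  nra.
set err := t * _ / _.
rewrite ltr_distlC => *; apply/andP; split; lra.
Unshelve. all: by end_near. Qed.

(** The slopes of the distance from [p] along a shortest path through [y] on
    both sides of [y] bound the cosine of the angle, by convexity. *)
Lemma angle_bounds p w y z : D p -> D w -> D y -> D z -> p <> y -> w <> y ->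
  y <> z -> mdist w y + mdist y z = mdist w z ->
  exists s, [/\ -1 <= s <= 1, angle p y z = acos (- s),
    mdist p y - mdist p w <= s * mdist w y &
    s * mdist y z <= mdist p z - mdist p y].
Proof.
move=> Dp Dw Dy Dz py wy yz wyz.
have [g [s [gP s1 aE sS glb]]] := angle_slope Dp Dy Dz py yz.
have wy0 := mdist_pos wy; have yz0 := mdist_pos yz; have [gs g0 gl] := gP.
exists s; split => //.
  rewrite -ler_pdivrMr//; apply: glb => t /andP[t0 tl].
  have ygt : mdist y (g t) = t.
    by rewrite -[X in mdist X _]g0 (shortest_pathE gs) ?subr0//; lra.
  have gtz : mdist (g t) z = mdist y z - t.
    by rewrite -[X in mdist _ X]gl (shortest_pathE gs)//; lra.
  have Dg : D (g t) by apply: between_mem Dy Dz _; lra.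
  (* Initial segments of a shortest path from y to z still prolong w y. *)
  have wygt : mdist w y + mdist y (g t) = mdist w (g t).
    apply/eqP; rewrite eq_le metric_triangle andbT.
    have := metric_triangle w (g t) z; lra.
  have := dist_convex Dp Dw Dg wygt; rewrite -wygt ygt => cvx.
  rewrite ler_pdivlMr// mulrAC ler_pdivrMr//; lra.
rewrite -ler_pdivlMr//; have := sS (mdist y z); rewrite gl; apply.
by rewrite yz0 lexx.
Qed.
End DomainFacts.

(** * Distance functions near a point *)

Lemma compact_cluster2 (R : realType) (X : metricType R) (D : set X)
    (u v : nat -> X) : compact D -> (forall n, D (u n)) -> (forall n, D (v n)) ->
  exists a b, [/\ D a, D b & forall e, 0 < e -> forall N, exists n,
    [/\ (N <= n)%N, mdist a (u n) < e & mdist b (v n) < e]].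
Proof.
move=> cD Du Dv.
have cDD := compact_setX cD cD.
have [] := cDD ((fun n => (u n, v n)) @ \oo) _ _.
  by exists 0%N => // n _ /=.
move=> [a b] [[/= Da Db] clus]; exists a, b; split => // e e0 N.
have [] := clus [set uv | exists2 n, (N <= n)%N & uv = (u n, v n)]
                (ball a e `*` ball b e).
- by exists N => // n /= Nn; exists n.
- by exists (ball a e, ball b e) => //; split; apply: nbhsx_ballx.
move=> _ [[n Nn ->] [/=]]; rewrite !ballEmdist /= => ua vb; by exists n.
Qed.

Section DomainEstimates.
Context {R : realType} {X : metricType R} (D : set X).
Hypothesis BD : busemann_domain D.
Implicit Types (p q x y z w v xb : X) (g : R -> X).

(** The difference quotients at [q] are monotone along each shortest path from
    [q], and contraction towards [q] makes them Lipschitz functions of the far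
    endpoint, uniformly in the scale; so they converge uniformly over the
    compact set of far endpoints. *)
Lemma nearly_conic p q r tau : D p -> D q -> 0 < r -> cball q r `<=` D ->
  0 < tau -> exists2 rho, 0 < rho & forall y z, q <> y ->
    mdist q y + mdist y z = mdist q z -> mdist q z <= rho ->
    (mdist p z - mdist p q) / mdist q z <= (mdist p y - mdist p q) / mdist q y + tau.
Proof.
move=> Dp Dq r0 rD tau0; apply: contrapT => no_rho.
have bad n : exists yzv : X * X * X, let: (y, z, v) := yzv in
    [/\ q <> y, mdist q y + mdist y z = mdist q z, mdist q z <= r / n.+1%:R,
      mdist q v = r /\ mdist z v = r - mdist q z &
      (mdist p y - mdist p q) / mdist q y + tau < (mdist p z - mdist p q) / mdist q z].
  apply: contrapT => no_yz; apply: no_rho; exists (r / n.+1%:R).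
    by rewrite divr_gt0.
  move=> y z qy qyz zn; rewrite leNgt; apply/negP => lt_tau; apply: no_yz.
  have zr : mdist q z <= r.
    by apply: le_trans zn _; rewrite ler_pdivrMr// ler_peMr ?(ltW r0)// ler1n.
  have qz : q <> z.
    by apply: mdist_gt0_neq; have := mdist_pos qy; have := mdist_ge0 y z; lra.
  have [v qv zv] := bd_extend BD Dq (rD _ zr) qz zr rD.
  by exists (y, z, v).
have [f fP] := choice bad.
have Dv n : D (f n).2.
  by have := fP n; case: (f n) => [[y z] v] /= [_ _ _ [qv _] _]; apply: rD; rewrite /cball/= qv.
(* The far endpoints v of a sequence of counterexamples accumulate at a. *)
have [a [b [Da _ near_a]]] := compact_cluster2 (bd_compact BD) Dv Dv.
have [g gP] := bd_path BD Dq Da.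
pose pt t := g (t * mdist q a).
pose S t := (mdist p (pt t) - mdist p q) / (t * r).
have [gs g0 gl] := gP; have qa0 := mdist_ge0 q a.
have ptR t : 0 <= t <= 1 -> at_ratio t q a (pt t) by exact: unit_speed_path_ratio.
have Smono t u : 0 < t -> t <= u -> u <= 1 -> S t <= S u.
  move=> t0 tu u1; have u0 : 0 < u by lra.
  have tu01 : 0 <= t / u <= 1.
    by apply/andP; split; [apply: divr_ge0; lra|rewrite ler_pdivrMr; lra].
  have uR : at_ratio u q a (pt u) by apply: ptR; lra.
  have Du : D (pt u) by apply: (bd_ratio BD _ Dq Da uR); lra.
  have tR : at_ratio (t / u) q (pt u) (pt t).
    have tua : t * mdist q a <= u * mdist q a by rewrite ler_wpM2r.
    have ua : u * mdist q a <= mdist q a by rewrite ler_piMl.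
    have ta0 : 0 <= t * mdist q a by rewrite mulr_ge0// ltW.
    have us : shortest_path 0 (u * mdist q a) g.
      by apply: (shortest_path_sub gs) => //; lra.
    rewrite -[X in at_ratio _ X]g0; apply: path_point_ratio us _ _.
      by apply/andP.
    by field; rewrite gt_eqF.
  have pR : at_ratio (t / u) p p p by rewrite /at_ratio mdistxx !mulr0.
  have := bd_convex BD tu01 Dp Dp Dq Du pR tR => cvx.
  rewrite /S ler_pdivrMr ?mulr_gt0// mulrAC ler_pdivlMr ?mulr_gt0//.
  have : u * (mdist p (pt t) - mdist p q) <= t * (mdist p (pt u) - mdist p q).
    have -> : t * (mdist p (pt u) - mdist p q) =
        u * ((1 - t / u) * mdist p q + t / u * mdist p (pt u) - mdist p q).
      by field; rewrite gt_eqF.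
    by rewrite ler_pM2l//; lra.
  nra.
pose E := [set S t | t in [set t | 0 < t <= 1]].
have Elb : has_lbound E.
  exists (- (mdist q a / r)) => _ [t /= /andP[t0 t1] <-].
  rewrite /S ler_pdivlMr ?mulr_gt0//.
  have := mdist_lipschitz p (pt t) q.
  have [ptE _] : at_ratio t q a (pt t) by apply: ptR; lra.
  rewrite (metric_sym (pt t)) ptE ler_norml => /andP[+ _].
  suff -> : - (mdist q a / r) * (t * r) = - (t * mdist q a) by [].
  by field; rewrite gt_eqF.
have [_ [t0 /= t0I <-] St0] : exists2 s, E s & s < inf E + tau / 4.
  apply: inf_adherent; first by lra.
  by split => //; exists (S 1), 1 => //=; lra.
have rtau : 0 < r * tau / 4 by rewrite divr_gt0// mulr_gt0.
have [n [nN an _]] := near_a _ rtau (Num.truncn t0^-1).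
have := fP n; move: an; case: (f n) => [[y z] v] /= av [qy qyz zn [qv zv] lt_tau].
have qy0 := mdist_pos qy; have yz0 := mdist_ge0 y z; have zv0 := mdist_ge0 z v.
have Dv' : D v by apply: rD; rewrite /cball/= qv.
have qyv : mdist q y + mdist y v = mdist q v.
  have := metric_triangle q y v; have := metric_triangle y z v; lra.
(* At equal ratios, the quotients towards v and towards a differ by at most
   the distance between v and a divided by r. *)
have close w : 0 < mdist q w -> mdist q w + mdist w v = mdist q v ->
    `|(mdist p w - mdist p q) / mdist q w - S (mdist q w / r)| <= tau / 4.
  move=> qw0 qwv; have wv0 := mdist_ge0 w v.
  have t01 : 0 <= mdist q w / r <= 1.
    by apply/andP; split; [apply: divr_ge0; lra|rewrite ler_pdivrMr; lra].
  have wR : at_ratio (mdist q w / r) q v w.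
    by rewrite -qv; apply: (between_ratio qwv _).1; apply: mdist_gt0_neq; rewrite qv.
  have := bd_convex BD t01 Dq Dv' Dq Da wR (ptR _ t01).
  rewrite mdistxx mulr0 add0r => wpt.
  rewrite /S divfK ?gt_eqF// -mulrBl normrM normfV (gtr0_norm qw0) ler_pdivrMr//.
  have -> : mdist p w - mdist p q - (mdist p (pt (mdist q w / r)) - mdist p q) =
    mdist p w - mdist p (pt (mdist q w / r)) by ring.
  apply: le_trans (mdist_lipschitz _ _ _) _; apply: le_trans wpt _.
  rewrite -mulrA mulrC ler_wpM2r ?(ltW qw0)// ler_pdivrMl//.
  by rewrite metric_sym; lra.
have qz0 : 0 < mdist q z by lra.
have qzv : mdist q z + mdist z v = mdist q v by rewrite qv zv; ring.
have /andP[t00 _] := t0I.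
have qzr : mdist q z / r <= t0.
  rewrite ler_pdivrMr// mulrC; apply: le_trans zn _; rewrite ler_wpM2l ?(ltW r0)//.
  rewrite invf_ple ?posrE//; apply: ltW; apply: lt_le_trans (truncnS_gt _) _.
  by rewrite ler_nat.
have Sz : S (mdist q z / r) <= S t0 by apply: Smono; rewrite ?divr_gt0//; lra.
have Sy : inf E <= S (mdist q y / r).
  apply: ge_inf => //; exists (mdist q y / r) => //=.
  by rewrite divr_gt0//= ler_pdivrMr// mul1r; lra.
have := close _ qy0 qyv; have := close _ qz0 qzv.
by rewrite !ler_norml; lra.
Qed.

End DomainEstimates.

(** * Prolongations backwards almost return *)

Section BrokenLines.
Context {R : realType} {X : metricType R} (D : set X).
Hypothesis BD : busemann_domain D.
Implicit Types (p q x y z w v xb : X) (g : R -> X).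

(** The configuration of a path that may miss [q]: [x] lies between [q] and
    [xb], whereas [xb], [y], [w], [v] lie in this order on one shortest path,
    which passes [x] at distance at most [t] and goes on for [s] up to [w]. *)
Record broken_line q r s t xb x y w v : Prop := BrokenLine {
  bl_D : D xb /\ D v;
  bl_xbq : mdist xb q = r;
  bl_xq : mdist x q = s;
  bl_xbx : mdist xb x = r - s;
  bl_xy : mdist x y <= t;
  bl_yw : mdist y w = s;
  bl_xbyw : mdist xb y + mdist y w = mdist xb w;
  bl_xbwv : mdist xb w + mdist w v = mdist xb v;
  bl_xbv : mdist xb v = 2 * r }.

Lemma broken_lineP q r s t xb x y w v : D q -> broken_line q r s t xb x y w v ->
  let T := mdist xb y in
  [/\ D y, r - s - t <= T <= r - s + t, mdist q y <= s + t & T + s <= 2 * r] /\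
  exists g, [/\ shortest_path 0 (2 * r) g, g 0 = xb, g (2 * r) = v, g T = y &
    g (T + s) = w].
Proof.
move=> Dq [[Dxb Dv] _ xq xbx xy yw xbyw xbwv xbv] T.
have xbw : mdist xb w = T + s by rewrite -xbyw yw.
have xbyv : mdist xb y + mdist y v = mdist xb v.
  apply/eqP; rewrite eq_le metric_triangle andbT.
  have := metric_triangle y w v; rewrite -xbwv -xbyw; lra.
split.
  split.
  - exact: (between_mem BD Dxb Dv xbyv).
  - have := mdist_lipschitz xb x y; rewrite xbx -/T ler_norml; lra.
  - have := metric_triangle q x y; rewrite (metric_sym q x) xq; lra.
  - by rewrite -xbw -xbv -xbwv lerDl mdist_ge0.
have [g gP] := bd_path BD Dxb Dv; exists g.
have gy := path_through BD Dxb Dv gP xbyv.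
have gw := path_through BD Dxb Dv gP xbwv.
by have [gs g0 gl] := gP; rewrite -xbw -xbv.
Qed.

(** The point is that [s1] enters the bound only with the small factor [e / r].
    If the second path comes much closer to [q] than the first, it also passes
    close to [y1]; as both paths end close together, convexity prevents them
    from separating between [y1] and [w1], so that [w1] stays close to the
    second path and hence to [q]. *)
Lemma broken_lines_close q r s1 t1 x1b x1 y1 w1 v1 s2 t2 x2b x2 y2 w2 v2 e :
  D q -> 0 < r -> 0 < s1 <= r -> t1 <= s1 -> 0 <= s2 ->
  broken_line q r s1 t1 x1b x1 y1 w1 v1 ->
  broken_line q r s2 t2 x2b x2 y2 w2 v2 ->
  mdist x1b x2b <= e -> mdist v1 v2 <= e ->
  mdist q w1 <= 4 * s2 + 4 * t2 + 3 * t1 + 2 * (s1 / r * e).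
Proof.
move=> Dq r0 /andP[s10 s1r] t1s1 s20 L1 L2 xbe ve.
have [[Dy1 T1I _ T1s1] [f [fs f0 fl fT1 fw1]]] := broken_lineP Dq L1.
have [[Dy2 T2I qy2 T2s2] [g [gs g0 gl gT2 gw2]]] := broken_lineP Dq L2.
have [D1 Dv1] := bl_D L1; have [D2 Dv2] := bl_D L2.
have x1y1 := bl_xy L1; have y2w2 := bl_yw L2.
have x1b_x1 : mdist x1b x1 = r - s1 := bl_xbx L1.
have x1_q : mdist x1 q = s1 := bl_xq L1.
have x1b_q : mdist x1b q = r := bl_xbq L1.
have D2b : mdist x2b v2 = 2 * r := bl_xbv L2.
move: (mdist_ge0 x1b y1) (mdist_ge0 x2b y2) => T10 T20.
move: (mdist x1b y1) (mdist x2b y2) T10 T20 T1I T1s1 fT1 fw1 T2I T2s2 gT2 gw2.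
move=> T1 T2 T10 T20 T1I T1s1 fT1 fw1 T2I T2s2 gT2 gw2 {L1 L2}.
have sT1 : 0 <= T1 <= 2 * r by apply/andP; split; lra.
have sT2 : 0 <= T2 <= 2 * r by apply/andP; split; lra.
have T1s : 0 <= T1 + s1 <= 2 * r by apply/andP; split; lra.
have T2s : 0 <= T2 + s2 <= 2 * r by apply/andP; split; lra.
have gD a b : 0 <= a <= 2 * r -> 0 <= b <= 2 * r -> mdist (g a) (g b) = `|a - b|.
  by move=> aI bI; apply: gs.2; rewrite in_itv.
have Dg a : 0 <= a <= 2 * r -> D (g a).
  move=> /andP[a0 a2r]; apply: (between_mem BD D2 Dv2).
  rewrite D2b -[X in mdist X (g a)]g0 -[X in mdist (g a) X]gl.
  by rewrite !(shortest_pathE gs) ?lexx// subr0 subrKC.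
(* The points at distance r - s1 from the starting points, on the sides
   ending at q, are s1 / r times as close as the starting points. *)
have y1y' : mdist y1 (g T1) <= t1 + s1 / r * e + (s2 + t2) + (t1 + s2 + t2).
  have [k kP] := bd_path BD D2 Dq.
  pose t := (r - s1) / r.
  have t0 : 0 <= t by rewrite divr_ge0 ?subr_ge0 ?(ltW r0).
  have t1' : t <= 1 by rewrite ler_pdivrMr// mul1r gerBl (ltW s10).
  have t01 : 0 <= t <= 1 by rewrite t0.
  have tr : t * r = r - s1 by rewrite divfK ?gt_eqF.
  have trs : (1 - t) = s1 / r by rewrite /t mulrBl divff ?gt_eqF// subKr.
  have x'R := unit_speed_path_ratio kP t01; set x' := k _ in x'R.
  have x1R : at_ratio t x1b q x1.
    by rewrite /at_ratio x1b_q x1b_x1 x1_q mulrBl tr mul1r subKr.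
  have x1x' := bd_convex BD t01 D1 Dq D2 Dq x1R x'R.
  rewrite mdistxx mulr0 addr0 trs in x1x'.
  have s1re : s1 / r * mdist x1b x2b <= s1 / r * e.
    by rewrite ler_wpM2l// divr_ge0 ?(ltW s10) ?(ltW r0).
  have tT2 : 0 <= t * T2 <= T2 by rewrite mulr_ge0//= ler_piMl.
  have tT2r : 0 <= t * T2 <= 2 * r.
    by case/andP: tT2 sT2 => -> /le_trans + /andP[_]; apply.
  have gs2 : shortest_path 0 T2 g.
    by case/andP: sT2 => T2_0 T2_r; exact: (shortest_path_sub gs).
  have y''R : at_ratio t x2b y2 (g (t * T2)).
    by rewrite -g0 -gT2; apply: path_point_ratio gs2 _ _; rewrite ?mulr0 ?add0r.
  have x'y'' := bd_convex BD t01 D2 Dq D2 Dy2 x'R y''R.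
  rewrite mdistxx mulr0 add0r in x'y''.
  have y''y' : mdist (g (t * T2)) (g T1) <= t1 + s2 + t2.
    rewrite gD//.
    have -> : t * T2 - T1 = (r - s1 - T1) + t * (T2 - r) by rewrite mulrBr tr; ring.
    apply: le_trans (ler_normD _ _) _; rewrite normrM (ger0_norm t0) -[leRHS]addrA.
    apply: lerD; first by rewrite ler_norml; lra.
    apply: le_trans (ler_piMl (normr_ge0 _) t1') _; rewrite ler_norml; lra.
  have tqy2 : t * mdist q y2 <= mdist q y2 by rewrite ler_piMl ?mdist_ge0.
  have := metric_triangle y1 x1 (g T1); have := metric_triangle x1 x' (g T1).
  have := metric_triangle x' (g (t * T2)) (g T1); rewrite (metric_sym y1 x1).
  clear - x1y1 x1x' s1re x'y'' y''y' tqy2 qy2; lra.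
(* Beyond y1 both lines are compared on the sides ending at v1 and v2. *)
have w1w' : mdist w1 (g (T1 + s1)) <= mdist y1 (g T1) + s1 / r * e.
  have rT1 : r <= 2 * r - T1 by lra.
  have rT1_gt0 : 0 < 2 * r - T1 := lt_le_trans r0 rT1.
  pose m := s1 / (2 * r - T1).
  have mT : m * (2 * r - T1) = s1 by rewrite divfK ?gt_eqF.
  have m0 : 0 <= m by rewrite divr_ge0 ?(ltW s10) ?(ltW rT1_gt0).
  have m1 : m <= 1 by rewrite ler_pdivrMr// mul1r (le_trans s1r).
  have m01 : 0 <= m <= 1 by rewrite m0.
  have mr : m <= s1 / r by rewrite /m ler_wpM2l ?lef_pV2 ?posrE ?(ltW s10).
  have mE : T1 + s1 = (1 - m) * T1 + m * (2 * r) by rewrite -mT; ring.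
  have T1s1I : T1 <= T1 + s1 <= 2 * r by rewrite lerDl (ltW s10).
  have [T1_0 T1_r] := andP sT1.
  have w1R : at_ratio m y1 v1 w1.
    rewrite -fT1 -fw1 -fl; apply: path_point_ratio T1s1I mE.
    exact: (shortest_path_sub fs).
  have w'R : at_ratio m (g T1) v2 (g (T1 + s1)).
    rewrite -gl; apply: path_point_ratio T1s1I mE.
    exact: (shortest_path_sub gs).
  apply: le_trans (bd_convex BD m01 Dy1 Dv1 (Dg _ sT1) Dv2 w1R w'R) _.
  apply: lerD; first by rewrite ler_piMl ?mdist_ge0// gerBl.
  by apply: ler_pM => //; exact: mdist_ge0.
have w'w2 : mdist (g (T1 + s1)) w2 <= t1 + t2 by rewrite -gw2 gD// ler_norml; lra.
have := metric_triangle q y2 w2; have := metric_triangle q w2 w1.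
have := metric_triangle w2 (g (T1 + s1)) w1.
rewrite (metric_sym w2 (g _)) (metric_sym (g _) w1).
clear - y1y' w1w' w'w2 y2w2 qy2; lra.
Qed.

(** Counterexamples at two very different scales, with both pairs of ends close
    to each other by compactness, contradict [broken_lines_close]. *)
Lemma prolongation_returns q r e : D q -> 0 < r -> cball q (3 * r) `<=` D ->
  0 < e -> exists2 rho, 0 < rho & forall x xb, q <> x -> mdist q x < rho ->
    mdist q xb = r -> mdist x xb = r - mdist q x ->
    exists2 t, 0 < t & forall y w, mdist x y < t -> mdist y w = mdist q x ->
      mdist xb y + mdist y w = mdist xb w -> mdist q w <= e * mdist q x.
Proof.
move=> Dq r0 rD e0; apply: contrapT => no_rho.
(* With t1 = k s1, t2 = k s2 and s2 < k s1, the bound of broken_lines_close is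
   at most 11 k s1 + 2 (s1 / r) (e r / 8), which is e s1 / 2 for k = e / 44. *)
pose k := Num.min 1 (e / 44).
have [k0 k1 ke] : [/\ 0 < k, k <= 1 & k <= e / 44].
  by rewrite /k lt_min ltr01 divr_gt0// !ge_min !lexx orbT.
have bad n : exists f : (X * X) * (X * X * X) ,
    let: (x, xb, (y, w, v)) := f in let s := mdist q x in
    [/\ 0 < s, s < r / n.+1%:R, broken_line q r s (k * s) xb x y w v & e * s < mdist q w].
  apply: contrapT => no_line; apply: no_rho; exists (r / n.+1%:R).
    by rewrite divr_gt0.
  move=> x xb /mdist_pos qx0 qxn qxb xxb; exists (k * mdist q x); first exact: mulr_gt0.
  move=> y w xy yw xbyw; rewrite leNgt; apply/negP => lt_e; apply: no_line.
  have xr : mdist q x < r.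
    by apply: lt_le_trans qxn _; rewrite ler_pdivrMr// ler_peMr ?(ltW r0)// ler1n.
  have kx : k * mdist q x <= mdist q x by rewrite ler_piMl// ltW.
  have xby := metric_triangle xb x y; rewrite (metric_sym xb x) xxb in xby.
  have Dxb : D xb by apply: rD; rewrite /cball/= qxb; lra.
  have xbw0 : xb <> w by apply: mdist_gt0_neq; have := mdist_ge0 xb y; lra.
  have ballxb : cball xb (2 * r) `<=` D.
    by move=> z; rewrite /cball/= => xbz; apply: rD; have := metric_triangle q xb z;
       rewrite /cball/=; lra.
  have Dw : D w by apply: ballxb; rewrite /cball/=; lra.
  have xbw : mdist xb w <= 2 * r by lra.
  have [v xbv wv] := bd_extend BD Dxb Dw xbw0 xbw ballxb.
  exists (x, xb, (y, w, v)) => /=; split => //.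
  split => //; rewrite ?wv ?xbv; try lra; rewrite 1?metric_sym//.
  by split => //; apply: ballxb; rewrite /cball/= xbv.
have [f fP] := choice bad.
pose fb n := (f n).1.2; pose fv n := (f n).2.2.
have Db n : D (fb n) /\ D (fv n).
  by rewrite /fb /fv; have := fP n; case: (f n) => [[x xb] [[y w] v]] /= [_ _ [Ds]].
have [a [b [_ _ near_ab]]] := compact_cluster2 (bd_compact BD)
  (fun n => (Db n).1) (fun n => (Db n).2).
have d0 : 0 < e * r / 16 by rewrite divr_gt0// mulr_gt0.
have [n [_ na nb]] := near_ab _ d0 0%N.
pose s n := mdist q (f n).1.1.
have s0 m : 0 < s m.
  by rewrite /s; have := fP m; case: (f m) => [[x xb] [[y w] v]] /= [].
(* A second configuration of much smaller scale than the first. *)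
have [m [mN ma mb]] := near_ab _ d0 (Num.truncn (r / (k * s n))).
have sm : s m < k * s n.
  apply: (@lt_le_trans _ _ (r / m.+1%:R)).
    by rewrite /s; have := fP m; case: (f m) => [[x xb] [[y w] v]] /= [].
  have ks0 : 0 < k * s n by rewrite mulr_gt0.
  rewrite ler_pdivrMr// mulrC -ler_pdivrMr//.
  by apply: ltW; apply: lt_le_trans (truncnS_gt _) _; rewrite ler_nat.
have sr : s n <= r.
  rewrite /s; have := fP n; case: (f n) => [[x xb] [[y w] v]] /= [_ lt_s _ _].
  by apply: le_trans (ltW lt_s) _; rewrite ler_pdivrMr// ler_peMr ?(ltW r0)// ler1n.
have fbnm : mdist (fb n) (fb m) <= e * r / 8.
  by have := metric_triangle (fb n) a (fb m); rewrite (metric_sym (fb n) a); lra.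
have fvnm : mdist (fv n) (fv m) <= e * r / 8.
  by have := metric_triangle (fv n) b (fv m); rewrite (metric_sym (fv n) b); lra.
have sn0 := s0 n; have sm0 := s0 m.
move: sn0 sm0 sr sm fbnm fvnm; rewrite /s /fb /fv.
have := fP n; case: (f n) => [[x1 x1b] [[y1 w1] v1]] /= [_ _ L1 lt1].
have := fP m; case: (f m) => [[x2 x2b] [[y2 w2] v2]] /= [_ _ L2 lt2].
move=> sn0 sm0 sr sm fbnm fvnm.
have s1I : 0 < mdist q x1 <= r by lra.
have ks1 : k * mdist q x1 <= mdist q x1 by rewrite ler_piMl// ltW.
have ks2 : k * mdist q x2 <= mdist q x2 by rewrite ler_piMl// ltW.
have := broken_lines_close Dq r0 s1I ks1 (ltW sm0) L1 L2 fbnm fvnm.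
have -> : mdist q x1 / r * (e * r / 8) = e * mdist q x1 / 8 by field; rewrite gt_eqF.
have : k * mdist q x1 <= e / 44 * mdist q x1 by rewrite ler_wpM2r// ltW.
lra.
Qed.

End BrokenLines.

(** * Strainers *)

Lemma near_in_seq (T : Type) (I : eqType) (F : set_system T) (FF : Filter F)
    (s : seq I) (P : I -> T -> Prop) :
  (forall i, i \in s -> \forall x \near F, P i x) ->
  \forall x \near F, forall i, i \in s -> P i x.
Proof.
elim: s => [|i s IH] Ps; first by near=> x.
have Pi := Ps i (mem_head _ _).
have {}IH : \forall x \near F, forall j, j \in s -> P j x.
  by apply: IH => j js; apply: Ps; rewrite in_cons js orbT.
near=> x => j; rewrite in_cons => /orP[/eqP ->|]; first by near: x.
by move: j; near: x.
Unshelve. all: by end_near. Qed.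

Section StrainerFacts.
Context {R : realType} {X : metricType R} (B : set X) (delta : R).

Lemma strainer1_near p x : strainer1 B delta p x ->
  \forall y \near x, strainer1 B delta p y.
Proof.
move=> [Bp [pbar [Bpbar [U [Ux UB Up Upbar Uang]]]]].
apply: filterS (nbhs_interior Ux) => y Uy.
by split => //; exists pbar; split => //; exists U.
Qed.

Lemma strainer_near k ps x : strainer B delta k ps x ->
  \forall y \near x, strainer B delta k ps y.
Proof.
elim=> {k ps x} [p x /strainer1_near|k ps p x _ IH /strainer1_near Sp].
  by apply: filterS => y; exact: strainer_base.
move=> [pbar [U [[Bpbar [V [Vx VB Vp Vpbar Vang]]] Ux UB Uout Uang]]].
near=> y; apply: strainer_step; [by near: y|by near: y|].
exists pbar, U; split => //; last by near: y; exact: nbhs_interior.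
split => //; exists V; split => //; near: y; exact: nbhs_interior.
Unshelve. all: by end_near. Qed.

Lemma strainer_neq k ps x : strainer B delta k ps x ->
  forall p, p \in ps -> p <> x.
Proof.
have neq1 p y : strainer1 B delta p y -> p <> y.
  move=> [_ [pbar [_ [U [Uy _ Up _ _]]]]] py; apply: Up; rewrite py.
  exact: nbhs_singleton.
elim=> {k ps x} [p x /neq1 px|k ps p x _ IH /neq1 px _] p'.
  by rewrite inE => /eqP ->.
by rewrite mem_rcons in_cons => /orP[/eqP ->|/IH].
Qed.

End StrainerFacts.

Section AngleFromSlope.
Context {R : realType}.
Implicit Types (d s : R).

Lemma acos_opp_gt d s : 0 < d < pi -> cos d < s -> -1 <= s <= 1 ->
  pi - d < acos (- s).
Proof.
move=> /andP[d0 dpi] ds s1; have sN : -1 <= - s <= 1 by lra.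
have [aI aE] := acos_def sN.
rewrite -ltr_cos ?in_itv/= ?aI//; last by apply/andP; split; lra.
rewrite aE addrC cosDpi cosN; lra.
Qed.

Lemma acos_opp_near_pihalf d s : 0 < d < pi / 2 -> `|s| < sin d ->
  -1 <= s <= 1 -> `|acos (- s) - pi / 2| < d.
Proof.
move=> /andP[d0 dpi] sd s1; have sN : -1 <= - s <= 1 by lra.
have [aI aE] := acos_def sN; have pi0 := @pi_gt0 R.
have /andP[sd1 sd2] : - sin d < s < sin d by rewrite -ltr_norml.
rewrite ltr_distl; apply/andP; split.
  rewrite -ltr_cos ?in_itv/= ?aI//; last by apply/andP; split; lra.
  by rewrite aE addrC cosDpihalf sinN; lra.
rewrite -ltr_cos ?in_itv/= ?aI//; last by apply/andP; split; lra.
by rewrite aE addrC cosDpihalf; lra.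
Qed.

End AngleFromSlope.

(** * Angles near [x] *)

Section StrainerAngles.
Context {R : realType} {X : metricType R} (D : set X).
Hypothesis BD : busemann_domain D.
Variables (q x : X) (r e s t : R).
Hypotheses (qxs : mdist q x = s) (Dq : D q) (rD : cball q (3 * r) `<=` D) (qx : q <> x)
  (le_sr : s <= r / 4) (gt0_e : 0 < e) (le_e16 : e <= 1 / 16) (le_t : t <= e * s).
Implicit Types (p y z w xb : X).

Definition conic_at p := forall y z, q <> y ->
  mdist q y + mdist y z = mdist q z -> mdist q z <= r ->
  (mdist p z - mdist p q) / mdist q z <= (mdist p y - mdist p q) / mdist q y + e.

Let scales : [/\ 0 < s, e * s <= s / 16, s <= r / 4, e <= 1 / 16 & t <= e * s].
Proof.
have s0 : 0 < s by rewrite -qxs; exact: mdist_pos.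
split => //; rewrite mulrC ler_wpM2l ?(ltW s0)//.
by have := le_e16; rewrite mul1r.
Qed.

(** [angle_bounds] is applied with [q] after [y] and, before [y], the end [z] of
    a prolongation of [q y] by [s].  The distance from [p] exceeds its value at
    [q] only little at [y], hence also at [z] because it is nearly conic. *)
Lemma angle_toward_center p y : D p -> conic_at p -> mdist p x = mdist p q ->
  p <> y -> mdist x y < t ->
  exists c, [/\ -1 <= c <= 1, angle p y q = acos (- c) & `|c| <= 8 * e].
Proof.
have [s0 es sr e16 ts] := scales; have e0 := gt0_e.
move=> Dp cone pxq py xy.
have := mdist_lipschitz p x y; rewrite pxq ler_norml => /andP[fy1 fy2].
have := mdist_lipschitz q x y; rewrite qxs ler_norml => /andP[qy1 qy2].
have qy0 : 0 < mdist q y by lra.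
have Dy : D y by apply: rD; rewrite /cball/=; lra.
have rD1 : cball q (mdist q y + s) `<=` D.
  by move=> z; rewrite /cball/= => qz; apply: rD; rewrite /cball/=; lra.
have [|z qz yz] := bd_extend BD Dq Dy (mdist_gt0_neq qy0) _ rD1.
  by lra.
have Dz : D z by apply: rD1; rewrite /cball/= qz.
have {}yz : mdist y z = s by rewrite yz; ring.
have zy : z <> y by apply: mdist_gt0_neq; rewrite metric_sym yz.
have yq : y <> q by apply: mdist_gt0_neq; rewrite metric_sym.
have zyq : mdist z y + mdist y q = mdist z q.
  by rewrite (metric_sym z y) (metric_sym z q) (metric_sym y q) yz qz; ring.
have [c [c1 aE lo hi]] := angle_bounds BD Dp Dz Dy Dq py zy yq zyq.
exists c; split => //; have es0 : 0 < e * s by rewrite mulr_gt0.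
rewrite (metric_sym z y) yz in lo; rewrite (metric_sym y q) in hi.
have qyz : mdist q y + mdist y z = mdist q z by rewrite yz qz.
have qz0 : 0 < mdist q z by lra.
have := cone _ _ (mdist_gt0_neq qy0) qyz; rewrite ler_pdivrMr// => /(_ _) cz.
have fy3 : (mdist p y - mdist p q) / mdist q y <= 2 * e.
  rewrite ler_pdivrMr//.
  have : 2 * e * (s - e * s) <= 2 * e * mdist q y by rewrite ler_wpM2l//; lra.
  have : e * (e * s) <= e * (s / 16) by rewrite ler_wpM2l ?es// ltW.
  lra.
have fz : mdist p z - mdist p q <= 7 * (e * s).
  have qzr : mdist q z <= r by lra.
  apply: le_trans (cz qzr) _.
  apply: le_trans (_ : (3 * e) * (33 / 16 * s) <= _); last lra.
  apply: le_trans (_ : 3 * e * mdist q z <= _).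
    by rewrite ler_wpM2r ?(ltW qz0)//; lra.
  by rewrite ler_wpM2l; lra.
have cs : - (8 * e) * s <= c * s by lra.
rewrite ler_pM2r // in cs.
have cqy : c * mdist q y <= (2 * e) * mdist q y.
  have : 2 * e * (s - e * s) <= 2 * e * mdist q y by rewrite ler_wpM2l//; lra.
  have : e * (e * s) <= e * (s / 16) by rewrite ler_wpM2l ?es// ltW.
  lra.
rewrite ler_pM2r // in cqy.
by rewrite ler_norml; apply/andP; split; lra.
Qed.

(** [angle_bounds] is applied with [xb] after [y] and [w] before [y].  At [w] the
    distance from [p] is close to its value at [q], since [w] is close to [q];
    at [xb] it exceeds that value only little, since it is nearly conic and
    takes the same value at [x]. *)
Lemma angle_toward_prolongation p y w xb : D p -> conic_at p ->
  mdist p x = mdist p q -> p <> y -> mdist x y < t -> D w -> D xb ->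
  mdist q xb = r -> mdist x xb = r - s ->
  mdist y w = s -> mdist xb y + mdist y w = mdist xb w -> mdist q w <= e * s ->
  exists c, [/\ -1 <= c <= 1, angle p y xb = acos (- c) & `|c| <= 8 * e].
Proof.
have [s0 es sr e16 ts] := scales; have e0 := gt0_e.
move=> Dp cone pxq py xy Dw Dxb qxb xxb yw xbyw qw.
have := mdist_lipschitz p x y; rewrite pxq ler_norml => /andP[fy1 fy2].
have := mdist_lipschitz p q w; rewrite ler_norml => /andP[fw1 fw2].
have := mdist_lipschitz q x y; rewrite qxs ler_norml => /andP[qy1 qy2].
have yxb := metric_triangle x y xb; rewrite xxb in yxb.
have Dy : D y by apply: rD; rewrite /cball/=; lra.
have es0 : 0 < e * s by rewrite mulr_gt0.
have yxb2 : r / 2 <= mdist y xb by lra.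
have wy : w <> y by apply: mdist_gt0_neq; rewrite metric_sym yw.
have yxb0 : y <> xb by apply: mdist_gt0_neq; lra.
have wyxb : mdist w y + mdist y xb = mdist w xb.
  by rewrite (metric_sym w y) (metric_sym y xb) (metric_sym w xb) -xbyw addrC.
have [c [c1 aE lo hi]] := angle_bounds BD Dp Dw Dy Dxb py wy yxb0 wyxb.
exists c; split => //; rewrite (metric_sym w y) yw in lo.
have cs : - (2 * e) * s <= c * s by lra.
rewrite ler_pM2r // in cs.
have r0 : 0 < r by lra.
have qxxb : mdist q x + mdist x xb = mdist q xb by rewrite xxb qxb qxs; ring.
have := cone _ _ qx qxxb; rewrite qxb pxq subrr mul0r add0r lexx => /(_ isT).
rewrite ler_pdivrMr// => fxb.
have er : e * s <= e * (r / 4) by rewrite ler_wpM2l// ltW.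
have cy : c * mdist y xb <= (4 * e) * mdist y xb.
  have : (4 * e) * (r / 2) <= (4 * e) * mdist y xb by rewrite ler_wpM2l//; lra.
  lra.
rewrite ler_pM2r // in cy; last lra.
by rewrite ler_norml; apply/andP; split; lra.
Qed.

(** From [w], close to [q], to [y] the distance from [q] grows by almost [s]. *)
Lemma angle_center_prolongation y w xb : mdist x y < t -> D w -> D xb ->
  mdist x xb = r - s ->
  mdist y w = s -> mdist xb y + mdist y w = mdist xb w -> mdist q w <= e * s ->
  exists c, [/\ -1 <= c <= 1, angle q y xb = acos (- c) & 1 - 2 * e <= c].
Proof.
have [s0 es sr e16 ts] := scales; have e0 := gt0_e.
move=> xy Dw Dxb xxb yw xbyw qw.
have := mdist_lipschitz q x y; rewrite qxs ler_norml => /andP[qy1 qy2].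
have yxb := metric_triangle x y xb; rewrite xxb in yxb.
have Dy : D y by apply: rD; rewrite /cball/=; lra.
have qy : q <> y by apply: mdist_gt0_neq; lra.
have wy : w <> y by apply: mdist_gt0_neq; rewrite metric_sym yw.
have yxb0 : y <> xb by apply: mdist_gt0_neq; lra.
have wyxb : mdist w y + mdist y xb = mdist w xb.
  by rewrite (metric_sym w y) (metric_sym y xb) (metric_sym w xb) -xbyw addrC.
have [c [c1 aE lo _]] := angle_bounds BD Dq Dw Dy Dxb qy wy yxb0 wyxb.
exists c; split => //; rewrite (metric_sym w y) yw in lo.
have cs : (1 - 2 * e) * s <= c * s by lra.
by rewrite ler_pM2r in cs.
Qed.

End StrainerAngles.

Theorem proposition5p7 (R : realType) :
  exists2 c : R, 0 < c &
    forall delta : R, 0 < delta -> delta < c ->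
    forall (X : metricType R), GNPC X ->
    forall (B : set X), tiny_ball B ->
    forall (k : nat), (2 <= k)%N ->
    forall (ps : seq X) (pk : X),
      (forall p, p \in ps -> B p) -> B pk ->
      strainer B delta k.-1 ps pk ->
    exists2 rho : R, 0 < rho &
      forall x : X, B x -> x <> pk -> mdist x pk < rho ->
        (forall p, p \in ps -> mdist p pk = mdist p x) ->
        strainer B delta k (rcons ps pk) x.
Proof.
have pi2 := @pi_ge2 R.
exists 1 => // delta d0 d1 X [_ _ lgc _] B [ctr [r0 [r0_gt0 BE cY YB]]] k k2 ps q Bps Bq Sq.
have BD := tiny_ball_busemann r0_gt0 cY YB lgc.
have ballP z : B z <-> mdist ctr z < r0 by rewrite BE ballEmdist.
have BinD z : B z -> cball ctr (3 * r0) z by move=> /ballP; rewrite /cball/=; lra.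
have oq : mdist ctr q < r0 by apply/ballP.
have oq0 := mdist_ge0 ctr q.
have Dq := BinD _ Bq.
have sind : 0 < sin delta by apply: sin_gt0_pi; lra.
have cosd : cos delta < 1.
  by rewrite -(@cos0 R) ltr_cos ?in_itv/=; lra.
pose e := Num.min (1 / 16) (Num.min (sin delta / 16) ((1 - cos delta) / 16)).
have [e0 e16 esin ecos] :
    [/\ 0 < e, e <= 1 / 16, e <= sin delta / 16 & e <= (1 - cos delta) / 16].
  by rewrite /e !lt_min !ge_min !lexx !orbT !divr_gt0// subr_gt0.
pose r1 := (r0 - mdist ctr q) / 2.
have r1_gt0 : 0 < r1 by rewrite /r1; lra.
have ballD : cball q (3 * r1) `<=` cball ctr (3 * r0).
  by move=> z; rewrite /cball/= /r1 => qz; have := metric_triangle ctr q z; lra.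
have ball1D : cball q r1 `<=` cball ctr (3 * r0).
  by move=> z qz; apply: ballD; move: qz; rewrite /cball/=; lra.
(* The scale r of the opposite strainer is small enough for all distances from
   points of the sequence to be conic at q up to r. *)
have [r [r_gt0 r_le cone]] : exists r, [/\ 0 < r, r <= r1 &
    forall p, p \in ps -> conic_at q r e p].
  have near_cone p : p \in ps -> \forall r \near 0^'+, conic_at q r e p.
    move=> /Bps/BinD Dp.
    have [rho rho0 rhoP] := nearly_conic BD Dp Dq r1_gt0 ball1D e0.
    near=> r => y z qy qyz qz; apply: rhoP => //; apply: le_trans qz _.
    by near: r; exact: nbhs_right_le.
  have near_r : \forall r \near 0^'+, [/\ 0 < r, r <= r1 &
      forall p, p \in ps -> conic_at q r e p].
    near=> r; split; near: r.
    - exact: nbhs_right_gt.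
    - exact: nbhs_right_le.
    - exact: near_in_seq.
  by have [r rP] := filter_ex near_r; exists r.
have ballrD : cball q (3 * r) `<=` cball ctr (3 * r0).
  by move=> z; rewrite /cball/= => qz; apply: ballD; rewrite /cball/=; lra.
have [rhoA rhoA0 returns] := prolongation_returns BD Dq r_gt0 ballrD e0.
have /metricType_numDomainType.nbhs_mdistP[rhoS /= rhoS0 strS] := strainer_near Sq.
exists (Num.min (Num.min rhoA rhoS) (r / 4)).
  by rewrite !lt_min rhoA0 rhoS0 divr_gt0.
move=> x Bx xq; have qx : q <> x by exact: nesym.
rewrite metric_sym !lt_min => /andP[/andP[xA xS] xr] psx.
have Dx := BinD _ Bx.
set s := mdist q x in xA xS xr *.
have s0 : 0 < s by exact: mdist_pos.
have rD1 : cball q r `<=` cball ctr (3 * r0).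
  by move=> z; rewrite /cball/= => qz; apply: ballrD; rewrite /cball/=; lra.
have sr : s <= r by lra.
have [xb qxb xxb] := bd_extend BD Dq Dx qx sr rD1.
have [tA tA0 retA] := returns x xb qx xA qxb xxb.
have Bxb : B xb by apply/ballP; have := metric_triangle ctr q xb; rewrite /r1 in r_le; lra.
pose t := Num.min tA (e * s).
have [t0 ttA te] : [/\ 0 < t, t <= tA & t <= e * s].
  by rewrite /t lt_min tA0 mulr_gt0// !ge_min !lexx orbT.
pose U := [set y | [/\ mdist x y < t, B y & forall p, p \in ps -> p <> y]].
have es16 : e * s <= s / 16 by rewrite mulrC ler_wpM2l ?(ltW s0)//; lra.
have UB : U `<=` B by move=> y [].
have Ux : nbhs x U.
  have near_t : \forall y \near x, mdist x y < t.
    by apply/metricType_numDomainType.nbhs_mdistP; exists t.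
  have near_B : \forall y \near x, B y.
    apply/metricType_numDomainType.nbhs_mdistP; exists (r0 - mdist ctr x) => /=.
      by rewrite subr_gt0; apply/ballP.
    by move=> y /= xy; apply/ballP; have := metric_triangle ctr x y; lra.
  have near_ps : \forall y \near x, forall p, p \in ps -> p <> y.
    apply: near_in_seq => p pps.
    have px : 0 < mdist x p.
      by rewrite metric_sym -psx//; apply: mdist_pos; exact: strainer_neq Sq _ pps.
    apply/metricType_numDomainType.nbhs_mdistP; exists (mdist x p) => //.
    by move=> y /= xy py; move: xy; rewrite py ltxx.
  by near=> y; split; near: y.
have Uq : ~ U q by move=> [+ _ _]; rewrite metric_sym -/s; lra.
have Uxb : ~ U xb by move=> [+ _ _]; rewrite xxb -/s; lra.
have Dxb := BinD _ Bxb.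
(* The point prolonging xb y by s, to which prolongation_returns applies. *)
have behind y : U y -> exists w, [/\ cball ctr (3 * r0) w, mdist y w = s,
    mdist xb y + mdist y w = mdist xb w & mdist q w <= e * s].
  move=> [xy /BinD Dy _].
  have xby := metric_triangle xb x y; rewrite (metric_sym xb x) xxb -/s in xby.
  have yxb := metric_triangle x y xb; rewrite xxb -/s (metric_sym y xb) in yxb.
  have xbD : cball xb (mdist xb y + s) `<=` cball ctr (3 * r0).
    move=> z; rewrite /cball/= => xbz; apply: ballrD; rewrite /cball/=.
    by have := metric_triangle q xb z; lra.
  have xby0 : xb <> y by apply: mdist_gt0_neq; lra.
  have [|w xbw yw] := bd_extend BD Dxb Dy xby0 _ xbD; first lra.
  have {}yw : mdist y w = s by rewrite yw; ring.
  have xbyw : mdist xb y + mdist y w = mdist xb w by rewrite xbw yw.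
  exists w; split => //; first by apply: xbD; rewrite /cball/= xbw.
  exact: (retA y w (lt_le_trans xy ttA) yw xbyw).
have sr4 : s <= r / 4 by lra.
have opp : opposite_strainer B delta q x xb.
  split => //; exists U; split => // y Uy.
  have [w [Dw yw xbyw qw]] := behind _ Uy; have [xy _ _] := Uy.
  have [c [c1 -> ec]] := angle_center_prolongation BD (erefl s) Dq ballrD qx sr4
    e0 e16 te xy Dw Dxb xxb yw xbyw qw.
  by apply: acos_opp_gt => //; lra.
case: k k2 Sq strS => [//|k] /= k1 Sq strS.
apply: strainer_step; first exact: strS.
  by split => //; exists xb.
exists xb, U; split => //.
  by split => // p pps [_ _ /(_ _ pps)].
move=> y p Uy pps; have [xy _ /(_ _ pps) py] := Uy.
have Dp := BinD _ (Bps _ pps); have cp := cone _ pps.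
have pxq : mdist p x = mdist p q by rewrite psx.
have [w [Dw yw xbyw qw]] := behind _ Uy.
have [c [c1 -> ec]] := angle_toward_center BD (erefl s) Dq ballrD qx sr4
  e0 e16 te Dp cp pxq py xy.
have [c' [c'1 -> ec']] := angle_toward_prolongation BD (erefl s) ballrD qx sr4
  e0 e16 te Dp cp pxq py xy Dw Dxb qxb xxb yw xbyw qw.
by split; apply: acos_opp_near_pihalf => //; lra.
Unshelve. all: by end_near. Qed.
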